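(* Let $k$ be an algebraically closed field, let $A,B$ be $k$-algebras, and let $F:B\text{-mod}\to A\text{-mod}$ be a representation embedding. Let $\Theta\in B\text{-mod}$ be indecomposable and let $((M_q,\chi_{M_q})_{q\in C_1},(N_t,\chi_{N_t})_{t\in C_2})$ be a strong independent pair of dense chains of $\Theta$-pointed $B$-modules such that $\chi_{M_q}$ and $\chi_{N_t}$ are monomorphisms for all $q\in C_1$, $t\in C_2$. Then $$\big((F(M_q),F(\chi_{M_q}))_{q\in C_1},\ (F(N_t),F(\chi_{N_t}))_{t\in C_2}\big)$$ is an independent pair of dense chains of $F(\Theta)$-pointed $A$-modules.
   Context: Conventions. $k$ is an algebraically closed field. A $k$-algebra means a finite-dimensional associative basic $k$-algebra with unit; modules are left modules. For a $k$-algebra $R$, $R\text{-mod}$ denotes the category of all finitely generated (equivalently, finite-dimensional) left $R$-modules. All functors are covariant. A functor $F: B\text{-mod}\to A\text{-mod}$ is a representation embedding if $F$ is exact, $F(X)\cong F(Y)$ implies $X\cong Y$ for all $X,Y\in B\text{-mod}$, and $F$ carries indecomposable modules to indecomposable modules. Pointed modules. Let $R$ be a $k$-algebra and $\Theta\in R\text{-mod}$. A $\Theta$-pointed $R$-module is a pair $(M,\chi_M)$ with $M\in R\text{-mod}$ and $\chi_M:\Theta\to M$ an $R$-homomorphism. A $\Theta$-pointed homomorphism $f:(M,\chi_M)\to(N,\chi_N)$ is an $R$-homomorphism $f:M\to N$ with $f\chi_M=\chi_N$; $(M,\chi_M)$ and $(N,\chi_N)$ are $\Theta$-isomorphic if there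 is such an $f$ which is an isomorphism of modules. The pointed pushout is $(M,\chi_M)*(N,\chi_N)=(M*N,\chi_{M*N})$, where $M*N=(M\oplus N)/\{(\chi_M(l),-\chi_N(l)): l\in\Theta\}$ is the pushout of $\chi_M$ and $\chi_N$, with canonical maps $\epsilon_M:M\to M*N$, $m\mapsto\overline{(m,0)}$, and $\epsilon_N:N\to M*N$, $n\mapsto\overline{(0,n)}$, and $\chi_{M*N}=\epsilon_M\chi_M=\epsilon_N\chi_N$. Dense chains. A $\mathbb{Q}$-chain is a nonempty countable dense totally ordered set without end points (so it is isomorphic as a poset to $\mathbb{Q}$). A dense chain of $\Theta$-pointed $R$-modules is a family $(M_q,\chi_{M_q})_{q\in C}$ of $\Theta$-pointed $R$-modules indexed by a $\mathbb{Q}$-chain $C$ such that: (a) the endomorphism ring $\mathrm{End}_R(M_q)$ is local and $\chi_{M_q}\neq 0$ for every $q\in C$; (b) for all $q<q'$ in $C$ there exists a $\Theta$-pointed homomorphism $(M_q,\chi_{M_q})\to(M_{q'},\chi_{M_{q'}})$; (c) $(M_q,\chi_{M_q})$ and $(M_{q'},\chi_{M_{q'}})$ are not $\Theta$-isomorphic for all $q\neq q'$ in $C$. An independent pair of dense chains of $\Theta$-pointed $R$-modules is a pair $((M_q,\chi_{M_q})_{q\in C_1},(N_t,\chi_{N_t})_{t\in C_2})$ of dense chains of $\Theta$-pointed $R$-modules such that: (a) $\mathrm{End}_R(M_q*N_t)$ is local for all $q\in C_1$, $t\in C_2$; (b) $(M_q,\chi_{M_q})*(N_t,\chi_{N_t})$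 is $\Theta$-isomorphic neither to $(M_{q'},\chi_{M_{q'}})*(N_t,\chi_{N_t})$ nor to $(M_q,\chi_{M_q})*(N_{t'},\chi_{N_{t'}})$, for all $q\neq q'$ in $C_1$ and $t\neq t'$ in $C_2$. Strong versions. A dense chain $(M_q,\chi_{M_q})_{q\in C}$ is strong if $M_q\not\cong M_{q'}$ as $R$-modules for all $q<q'$ in $C$. An independent pair $((M_q,\chi_{M_q})_{q\in C_1},(N_t,\chi_{N_t})_{t\in C_2})$ of dense chains is strong if both dense chains are strong and $M_q*N_t$ is isomorphic as an $R$-module neither to $M_{q'}*N_t$ nor to $M_q*N_{t'}$, for all $q\neq q'$ in $C_1$ and $t\neq t'$ in $C_2$. *)

(* Defs.v *)
From HB Require Import structures.
From mathcomp Require Import all_boot all_order all_algebra.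
From mathcomp Require Import ring_quotient falgebra.
From mathcomp Require Import boolp classical_sets functions cardinality.

Set Implicit Arguments.
Unset Strict Implicit.
Unset Printing Implicit Defensive.

Import Order.TTheory GRing.Theory.

Local Open Scope ring_scope.
Local Open Scope quotient_scope.

Lemma linear_ext (R : pzRingType) (M N : lmodType R) (f g : {linear M -> N}) :
  f =1 g -> f = g.
Proof.
case: f g => [f [[fD] [fZ]]] [g [[gD] [gZ]]] /= /funext fg.
by case: _ / fg gD gZ => gD gZ; rewrite (Prop_irrelevance fD gD) (Prop_irrelevance fZ gZ).
Qed.

(* Over a finite-dimensional k-algebra these are the modules of finite        *)
(* dimension over k, k acting through c |-> c%:A.                             *)
Definition finitely_generated (R : pzRingType) (M : lmodType R) : Prop :=
  exists (n : nat) (g : 'I_n -> M),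
    forall x : M, exists c : 'I_n -> R, x = \sum_(i < n) c i *: g i.

Record fgmod (R : pzRingType) := FGMod {
  fgmod_sort :> lmodType R;
  fgmodP : finitely_generated fgmod_sort }.

Section Modules.
Variable R : pzRingType.

Definition isomorphic (M N : lmodType R) : Prop :=
  exists f : {linear M -> N}, bijective f.

Definition short_exact (X Y Z : lmodType R)
    (f : {linear X -> Y}) (g : {linear Y -> Z}) : Prop :=
  [/\ injective f,
      forall y, g y = 0 <-> exists x, f x = y
    & forall z, exists y, g y = z].

Lemma zeromod_fg : finitely_generated 'rV[R]_0.
Proof.
by exists 0, (fun=> 0) => x; exists (fun=> 0); rewrite big_ord0 [x]thinmx0.
Qed.

Definition zeromod : fgmod R := FGMod zeromod_fg.

Lemma dsum_fg (M N : fgmod R) : finitely_generated (M * N)%type.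
Proof.
case: (fgmodP M) (fgmodP N) => m [g gP] [n [h hP]].
exists (m + n)%N, (fun i => match fintype.split i with
  | inl i => (g i, 0) | inr j => (0, h j) end) => -[x y].
have [c xE] := gP x; have [d yE] := hP y.
exists (fun i => match fintype.split i with inl i => c i | inr j => d j end).
rewrite big_split_ord /=.
under eq_bigr do rewrite (unsplitK (inl _)).
under [X in _ + X]eq_bigr do rewrite (unsplitK (inr _)).
apply: injective_projections => /=.
  rewrite !raddf_sum /= [X in _ + X]big1 ?addr0 // => i _; exact: scaler0.
by rewrite !raddf_sum /= [X in X + _]big1 ?add0r // => i _; exact: scaler0.
Qed.

Definition dsum (M N : fgmod R) : fgmod R := FGMod (dsum_fg M N).

Definition trivial_mod (M : lmodType R) : Prop := forall x : M, x = 0.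

Definition indecomposable (M : fgmod R) : Prop :=
  ~ trivial_mod M /\
  forall X Y : fgmod R, isomorphic M (dsum X Y) -> trivial_mod X \/ trivial_mod Y.

End Modules.

Definition endo (R : pzRingType) (M : lmodType R) : Type := {linear M -> M}.

Section EndoRing.
Variables (R : pzRingType) (M : lmodType R).
Implicit Types f g h : endo M.

HB.instance Definition _ := gen_eqMixin (endo M).
HB.instance Definition _ := gen_choiceMixin (endo M).

Definition endo_zero : endo M := \0.
Definition endo_opp f : endo M := \- f.
Definition endo_add f g : endo M := f \+ g.
Definition endo_one : endo M := idfun.
Definition endo_mul f g : endo M := f \o g.

Fact endo_addA : associative endo_add.
Proof. by move=> f g h; apply: linear_ext => x; exact: addrA. Qed.
Fact endo_addC : commutative endo_add.
Proof. by move=> f g; apply: linear_ext => x; exact: addrC. Qed.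
Fact endo_add0 : left_id endo_zero endo_add.
Proof. by move=> f; apply: linear_ext => x; exact: add0r. Qed.
Fact endo_addN : left_inverse endo_zero endo_opp endo_add.
Proof. by move=> f; apply: linear_ext => x; exact: addNr. Qed.

HB.instance Definition _ :=
  GRing.isZmodule.Build (endo M) endo_addA endo_addC endo_add0 endo_addN.

Fact endo_mulA : associative endo_mul.
Proof. by move=> f g h; apply: linear_ext. Qed.
Fact endo_mul1 : left_id endo_one endo_mul.
Proof. by move=> f; apply: linear_ext. Qed.
Fact endo_mulr1 : right_id endo_one endo_mul.
Proof. by move=> f; apply: linear_ext. Qed.
Fact endo_mulDl : left_distributive endo_mul +%R.
Proof. by move=> f g h; apply: linear_ext. Qed.
Fact endo_mulDr : right_distributive endo_mul +%R.
Proof. by move=> f g h; apply: linear_ext => x; exact: linearD. Qed.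

HB.instance Definition _ := GRing.Zmodule_isPzRing.Build (endo M)
  endo_mulA endo_mul1 endo_mulr1 endo_mulDl endo_mulDr.

End EndoRing.

Definition invertible (S : pzRingType) (x : S) : Prop :=
  exists y : S, y * x = 1 /\ x * y = 1.

(* The ring is not required to be commutative: the nonunits are closed under  *)
(* addition, equivalently there is a unique maximal left ideal.               *)
Definition local_ring (S : pzRingType) : Prop :=
  (1 : S) <> 0 /\
  forall x y : S, ~ invertible x -> ~ invertible y -> ~ invertible (x + y).

(* In the decomposition of the regular left module into indecomposables, no   *)
(* isomorphism class is repeated.                                             *)
Definition basic (k : fieldType) (A : falgType k) : Prop :=
  exists s : seq (fgmod A),
    [/\ isomorphic A^o (foldr (@dsum A) (zeromod A) s),
        forall i, (i < size s)%N -> indecomposable (nth (zeromod A) s i)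
      & forall i j, (i < j < size s)%N ->
          ~ isomorphic (nth (zeromod A) s i) (nth (zeromod A) s j)].

(* Neither k-linearity nor additivity is required; exact functors are additive. *)
Record functor (S R : pzRingType) := Functor {
  fobj :> fgmod S -> fgmod R;
  fmor : forall M N : fgmod S, {linear M -> N} -> {linear fobj M -> fobj N};
  fmor_id : forall M : fgmod S, fmor (idfun : {linear M -> M}) =1 id;
  fmor_comp : forall (M N P : fgmod S)
      (g : {linear N -> P}) (f : {linear M -> N}),
    fmor (g \o f : {linear M -> P}) =1 fmor g \o fmor f }.

Section RepresentationEmbedding.
Variables (S R : pzRingType) (F : functor S R).

Definition exact_functor : Prop :=
  forall (X Y Z : fgmod S) (f : {linear X -> Y}) (g : {linear Y -> Z}),
    short_exact f g -> short_exact (fmor F f) (fmor F g).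

Definition representation_embedding : Prop :=
  [/\ exact_functor,
      forall X Y : fgmod S, isomorphic (F X) (F Y) -> isomorphic X Y
    & forall X : fgmod S, indecomposable X -> indecomposable (F X)].

End RepresentationEmbedding.

(* ring_quotient only provides quotients of additive groups, so the scaling   *)
(* on the quotient of M * N is added by hand.                                 *)
Section PushoutModule.
Variables (R : pzRingType) (Theta M N : lmodType R).
Variables (f : {linear Theta -> M}) (g : {linear Theta -> N}).

Definition pushout_rel : {pred M * N} :=
  fun z => `[< exists l : Theta, z = (f l, - g l) >].

Fact pushout_rel_zmod_closed : zmod_closed pushout_rel.
Proof.
split=> [|_ _ /asboolP[l ->] /asboolP[l' ->]]; apply/asboolP.
  by exists 0; apply: injective_projections; rewrite /= linear0 ?oppr0.
by exists (l - l'); rewrite !linearB; apply: injective_projections.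
Qed.
HB.instance Definition _ := GRing.isZmodClosed.Build (M * N)%type pushout_rel
  pushout_rel_zmod_closed.

Definition pushout := Quotient.quot pushout_rel.
HB.instance Definition _ := GRing.Zmodule.on pushout.
HB.instance Definition _ := EqQuotient.on pushout.

Definition pushout_scale (a : R) := lift_op1 pushout ( *:%R a).

Fact pi_pushout_scale a : {morph \pi_pushout : z / a *: z >-> pushout_scale a z}.
Proof.
move=> z; unlock pushout_scale; apply/eqP.
rewrite -Quotient.idealrBE -scalerBr.
have : z - repr (\pi_pushout z) \in pushout_rel by rewrite Quotient.idealrBE reprK.
move=> /asboolP[l ->]; apply/asboolP; exists (a *: l).
by rewrite !linearZ; apply: injective_projections; rewrite //= scalerN.
Qed.

Fact pushout_scaleA a b z :
  pushout_scale a (pushout_scale b z) = pushout_scale (a * b) z.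
Proof. by elim/quotW: z => z; rewrite -!pi_pushout_scale scalerA. Qed.
Fact pushout_scale1 : left_id 1 pushout_scale.
Proof. by elim/quotW=> z; rewrite -pi_pushout_scale scale1r. Qed.
Fact pushout_scaleDr : right_distributive pushout_scale +%R.
Proof.
move=> a; elim/quotW=> x; elim/quotW=> y.
by rewrite -raddfD -!pi_pushout_scale -raddfD scalerDr.
Qed.
Fact pushout_scaleDl z : {morph pushout_scale^~ z : a b / a + b}.
Proof.
by elim/quotW: z => z a b; rewrite -!pi_pushout_scale scalerDl raddfD.
Qed.
HB.instance Definition _ := GRing.Zmodule_isLmodule.Build R pushout
  pushout_scaleA pushout_scale1 pushout_scaleDr pushout_scaleDl.

Definition pushout_inl (m : M) : pushout := \pi_pushout (m, 0).
Definition pushout_inr (n : N) : pushout := \pi_pushout (0, n).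

Fact pushout_inl_linear : linear pushout_inl.
Proof.
move=> a x y; rewrite /pushout_inl -[RHS]/(pushout_scale a _ + _).
rewrite -pi_pushout_scale -raddfD; congr \pi_pushout.
by apply: injective_projections; rewrite //= scaler0 addr0.
Qed.
HB.instance Definition _ := GRing.isLinear.Build R M pushout *:%R pushout_inl
  pushout_inl_linear.

Fact pushout_inr_linear : linear pushout_inr.
Proof.
move=> a x y; rewrite /pushout_inr -[RHS]/(pushout_scale a _ + _).
rewrite -pi_pushout_scale -raddfD; congr \pi_pushout.
by apply: injective_projections; rewrite //= scaler0 addr0.
Qed.
HB.instance Definition _ := GRing.isLinear.Build R N pushout *:%R pushout_inr
  pushout_inr_linear.

Lemma pushout_comm l : pushout_inl (f l) = pushout_inr (g l).
Proof.
apply/eqP; rewrite -Quotient.idealrBE; apply/asboolP; exists l.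
by apply: injective_projections; rewrite /= ?subr0 ?sub0r.
Qed.

End PushoutModule.

Lemma pushout_fg (R : pzRingType) (Theta : lmodType R) (M N : fgmod R)
    (f : {linear Theta -> M}) (g : {linear Theta -> N}) :
  finitely_generated (pushout f g).
Proof.
have [n [h hP]] := fgmodP (dsum M N).
exists n, (fun i => \pi_(pushout f g) (h i)).
elim/quotW=> z; have [c ->] := hP z; exists c.
rewrite raddf_sum; apply: eq_bigr => i _.
exact: pi_pushout_scale.
Qed.

Record pointed (R : pzRingType) (Theta : fgmod R) := Pointed {
  pmod :> fgmod R;
  chi : {linear Theta -> pmod} }.

Section PointedModules.
Variables (R : pzRingType) (Theta : fgmod R).
Implicit Types M N : pointed Theta.

Definition pointed_hom M N (f : {linear M -> N}) : Prop :=
  f \o chi M =1 chi N.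

Definition pointed_iso M N : Prop :=
  exists f : {linear M -> N}, pointed_hom f /\ bijective f.

Definition pointed_pushout M N : pointed Theta :=
  @Pointed R Theta (FGMod (pushout_fg (chi M) (chi N)))
    (@pushout_inl R Theta M N (chi M) (chi N) \o chi M).

End PointedModules.

Definition pointed_image (S R : pzRingType) (F : functor S R)
    (Theta : fgmod S) (M : pointed Theta) : pointed (F Theta) :=
  @Pointed R (F Theta) (F M) (fmor F (chi M)).

Definition Q_chain (d : Order.disp_t) (C : orderType d) : Prop :=
  [/\ inhabited C,
      countable [set: C],
      forall x y : C, (x < y)%O -> exists z : C, (x < z)%O /\ (z < y)%O,
      forall x : C, exists y : C, (y < x)%O
    & forall x : C, exists y : C, (x < y)%O].

Section DenseChains.
Variables (R : pzRingType) (Theta : fgmod R).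

Definition dense_chain (d : Order.disp_t) (C : orderType d)
    (M : C -> pointed Theta) : Prop :=
  [/\ Q_chain C,
      forall q, local_ring (endo (M q)) /\ ~ (forall l, chi (M q) l = 0),
      forall q q', (q < q')%O ->
        exists f : {linear M q -> M q'}, pointed_hom f
    & forall q q', q <> q' -> ~ pointed_iso (M q) (M q')].

Definition strong_dense_chain (d : Order.disp_t) (C : orderType d)
    (M : C -> pointed Theta) : Prop :=
  dense_chain M /\ forall q q', (q < q')%O -> ~ isomorphic (M q) (M q').

Definition independent_pair (d1 d2 : Order.disp_t)
    (C1 : orderType d1) (C2 : orderType d2)
    (M : C1 -> pointed Theta) (N : C2 -> pointed Theta) : Prop :=
  [/\ dense_chain M,
      dense_chain N,
      forall q t, local_ring (endo (pointed_pushout (M q) (N t)))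
    & forall q q' t t', q <> q' -> t <> t' ->
        ~ pointed_iso (pointed_pushout (M q) (N t))
                      (pointed_pushout (M q') (N t)) /\
        ~ pointed_iso (pointed_pushout (M q) (N t))
                      (pointed_pushout (M q) (N t'))].

Definition strong_independent_pair (d1 d2 : Order.disp_t)
    (C1 : orderType d1) (C2 : orderType d2)
    (M : C1 -> pointed Theta) (N : C2 -> pointed Theta) : Prop :=
  [/\ independent_pair M N,
      strong_dense_chain M,
      strong_dense_chain N
    & forall q q' t t', q <> q' -> t <> t' ->
        ~ isomorphic (pointed_pushout (M q) (N t))
                     (pointed_pushout (M q') (N t)) /\
        ~ isomorphic (pointed_pushout (M q) (N t))
                     (pointed_pushout (M q) (N t'))].

End DenseChains.

(* Main.v *)
Require Import Defs.
From HB Require Import structures.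
From mathcomp Require Import boolp.
From mathcomp Require Import all_boot all_order all_algebra falgebra.

Set Implicit Arguments.
Unset Strict Implicit.
Unset Printing Implicit Defensive.

Import Order.TTheory GRing.Theory.

Local Open Scope ring_scope.
Local Open Scope quotient_scope.

(** The heart of the matter is that the functor [F] commutes with the pointed
    pushouts that occur, and that it preserves modules with local endomorphism
    ring; strongness then does the rest, since [F] reflects isomorphism of
    modules, though not necessarily of pointed modules.

    For [f : Theta -> M] injective and [g : Theta -> N], the pushout is the
    cokernel in the short exact sequence
      [0 -> Theta -> M + N -> M * N -> 0],
    so an exact functor that preserves finite direct sums turns it into the
    pushout of [F f] and [F g] ([functor_pushout]).  That [F] preserves
    direct sums follows from exactness alone: [F] kills the zero module, since
    [0 -> 0 -> 0] with identity maps is short exact, hence it kills zero maps,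
    and it preserves the split sequence [0 -> X -> X + Y -> Y -> 0] together
    with the retraction of its inclusion and the section of its projection.

    A module with local endomorphism ring is indecomposable because two
    complementary projections add up to the identity
    ([local_endo_indecomposable]).  The converse is Fitting's lemma, valid for
    finitely generated modules over a finite-dimensional algebra
    ([indecomposable_local_endo]).  By Cayley-Hamilton an endomorphism [f] is
    algebraic over the base field, whence [f ^+ m = f ^+ m.+1 * g] for some [g]
    commuting with [f]; then [(f * g) ^+ m] is an idempotent which is [1]
    only if [f] is invertible and [0] only if [f] is nilpotent, once [m] is
    taken positive.  As [F] preserves indecomposability, it therefore preserves
    locality of endomorphism rings.

    Now a pointed isomorphism between two of the modules [F (M q)], or between
    two of the pushouts [F (M q) * F (N t)], yields a plain isomorphism between
    the corresponding modules before [F] is applied, which strongness excludes.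
    Finally [F (chi (M q))] is injective with nonzero source [F Theta], because
    [Theta] is indecomposable; so it is nonzero. *)

(** * Linear maps and isomorphisms *)

Section LinearMaps.
Variable R : pzRingType.

Lemma inj_surj_bijective (T U : Type) (f : T -> U) :
  injective f -> (forall y, exists x, f x = y) -> bijective f.
Proof.
by move=> f_inj /choice[g fg]; exists g => // x; apply: f_inj; rewrite fg.
Qed.

Lemma linear_inj0 (M N : lmodType R) (f : {linear M -> N}) :
  (forall x, f x = 0 -> x = 0) -> injective f.
Proof.
by move=> f0 x y fxy; apply/subr0_eq/f0; rewrite linearB /= fxy subrr.
Qed.

(** By the first isomorphism theorem both targets are the quotient of the source
    by the common kernel. *)
Lemma isomorphic_of_surj (X P Q : lmodType R)
    (u : {linear X -> P}) (v : {linear X -> Q}) :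
  (forall p, exists x, u x = p) -> (forall q, exists x, v x = q) ->
  (forall x, u x = 0 <-> v x = 0) -> isomorphic P Q.
Proof.
move=> /choice[s us] v_surj uv.
have vE x y : u x = u y -> v x = v y.
  by move=> uxy; apply/subr0_eq; rewrite -linearB; apply/uv;
    rewrite linearB /= uxy subrr.
have vs_linear : linear (v \o s).
  by move=> a p q /=; rewrite -linearP; apply: vE; rewrite linearP !us.
pose phi : {linear P -> Q} :=
  HB.pack (v \o s) (GRing.isLinear.Build R P Q *:%R (v \o s) vs_linear).
exists phi; apply: inj_surj_bijective => [|q].
  apply: linear_inj0 => p /uv; by rewrite us.
have [x <-] := v_surj q; exists (u x); apply: vE; exact: us.
Qed.

Lemma linear_inverse (M N : lmodType R) (f : {linear M -> N}) :
  bijective f -> exists g : {linear N -> M}, cancel f g /\ cancel g f.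
Proof.
case=> g fK gK; have g_linear : linear g.
  by move=> a x y; apply: (can_inj fK); rewrite linearP /= !gK.
pose g' : {linear N -> M} :=
  HB.pack g (GRing.isLinear.Build R N M *:%R g g_linear).
by exists g'.
Qed.

Lemma isomorphic_sym (M N : lmodType R) : isomorphic M N -> isomorphic N M.
Proof. by case=> f /linear_inverse[g [fK gK]]; exists g, f. Qed.

Lemma isomorphic_trans (M N P : lmodType R) :
  isomorphic M N -> isomorphic N P -> isomorphic M P.
Proof.
move=> [f f_bij] [g g_bij]; exists (g \o f : {linear M -> P}).
exact: bij_comp.
Qed.

Lemma indecomposable_iso (M N : fgmod R) :
  isomorphic M N -> indecomposable M -> indecomposable N.
Proof.
move=> MN [M_neq0 M_split]; split=> [N0|X Y NXY].
  case: MN => f /bij_inj f_inj; apply: M_neq0 => x.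
  by apply: f_inj; rewrite linear0; exact: N0.
exact/M_split/(isomorphic_trans MN).
Qed.

Definition pairing (X M N : lmodType R) (f : {linear X -> M})
  (g : {linear X -> N}) : X -> M * N := fun x => (f x, g x).

Fact pairing_linear X M N f g : linear (@pairing X M N f g).
Proof. by move=> a x y; rewrite /pairing !linearP. Qed.

HB.instance Definition _ (X M N : lmodType R) f g :=
  GRing.isLinear.Build R X (M * N)%type *:%R
    (@pairing X M N f g) (pairing_linear f g).

Definition copairing (M N P : lmodType R) (a : {linear M -> P})
  (b : {linear N -> P}) : {linear (M * N)%type -> P} :=
  (a \o fst) \+ (b \o snd).

End LinearMaps.

(** * Pushouts and cokernels *)

Section Pushout.
Variables (R : pzRingType) (Theta M N : lmodType R).
Variables (f : {linear Theta -> M}) (g : {linear Theta -> N}).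

Local Notation inl := (@pushout_inl R Theta M N f g).
Local Notation inr := (@pushout_inr R Theta M N f g).

Lemma pushout_piE z : inl z.1 + inr z.2 = \pi_(pushout f g) z.
Proof.
rewrite /pushout_inl /pushout_inr -raddfD; congr \pi_(_).
by case: z => x y; apply: injective_projections; rewrite /= ?addr0 ?add0r.
Qed.

Lemma pushout_surj (w : pushout f g) : exists z, copairing inl inr z = w.
Proof. by elim/quotW: w => z; exists z; exact: pushout_piE. Qed.

Lemma pushout_eq0 z :
  copairing inl inr z = 0 <-> exists l, pairing f (\- g) l = z.
Proof.
rewrite [copairing _ _ _]pushout_piE.
have -> : (\pi_(pushout f g) z = 0) <-> (z \in pushout_rel f g).
  have := Quotient.idealrBE (pushout_rel f g) z 0; rewrite subr0 => ->.
  rewrite raddf0; exact: (rwP eqP).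
split=> [/asboolP[l ->]|[l <-]]; first by exists l.
by apply/asboolP; exists l.
Qed.

Lemma pushout_inr_inj : injective f -> injective inr.
Proof.
move=> f_inj; apply: linear_inj0 => y y0.
have [|l [fl0 <-]] := (pushout_eq0 (0, y)).1.
  by rewrite /copairing /= linear0 add0r.
have -> : l = 0 by apply: f_inj; rewrite fl0 linear0.
by rewrite /= linear0 oppr0.
Qed.

(** The sign makes the composite zero: [inl (f l)] and [inr (g l)] agree in the
    pushout. *)
Lemma pushout_short_exact :
  injective f -> short_exact (pairing f (\- g)) (copairing inl inr).
Proof.
move=> f_inj; split; [|exact: pushout_eq0|exact: pushout_surj].
by move=> l l' [/f_inj].
Qed.

End Pushout.

Section Cokernel.
Variables (R : pzRingType) (X M : fgmod R) (f : {linear X -> M}).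

(** The quotient of [M] by the image of [f] is the pushout of [f] along the map
    to the zero module. *)
Definition coker : fgmod R :=
  FGMod (pushout_fg f (\0 : {linear X -> zeromod R})).

Definition coker_proj : {linear M -> coker} :=
  @pushout_inl R X M (zeromod R) f \0.

Lemma coker_proj_eq0 x : coker_proj x = 0 <-> exists l, f l = x.
Proof.
have := @pushout_eq0 R X M (zeromod R) f \0 (x, 0).
rewrite /copairing /= linear0 addr0 => ->.
split=> -[l] => [[fl _]|fl]; exists l => //.
by apply: injective_projections; rewrite /= ?oppr0.
Qed.

Lemma coker_proj_surj w : exists x, coker_proj x = w.
Proof.
have [[x y] <-] := pushout_surj w.
by exists x; rewrite /copairing /= [y]thinmx0 linear0 addr0.
Qed.

Lemma coker_short_exact : injective f -> short_exact f coker_proj.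
Proof.
by move=> f_inj; split; [|exact: coker_proj_eq0|exact: coker_proj_surj].
Qed.

End Cokernel.

(** * Exact functors *)

Section ExactFunctor.
Variables (S R : pzRingType) (F : functor S R) (F_exact : exact_functor F).

Lemma fmor_inj (X Y : fgmod S) (f : {linear X -> Y}) :
  injective f -> injective (fmor F f).
Proof. by move=> /coker_short_exact/F_exact[]. Qed.

Lemma fmor_comp_eq (X Y Z : fgmod S) (g : {linear Y -> Z})
    (f : {linear X -> Y}) (h : {linear X -> Z}) :
  g \o f =1 h -> forall x, fmor F g (fmor F f x) = fmor F h x.
Proof.
move=> gf x; rewrite -[LHS](@fmor_comp S R F X Y Z g f x); congr (fmor F _ x).
exact: linear_ext.
Qed.

(** A short exact sequence has zero composite, and [0 -> 0 -> 0] with identity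
    maps is short exact; so [F] annihilates the zero module, through which every
    zero map factors. *)
Lemma fmor0 (X Y : fgmod S) x : fmor F (\0 : {linear X -> Y}) x = 0.
Proof.
have zero_exact : short_exact (idfun : {linear zeromod S -> zeromod S}) idfun.
  split=> // y; last by exists y.
  by split=> _; [exists y | exact: thinmx0].
have F0 (y : F (zeromod S)) : y = 0.
  have [_ y0 _] := F_exact zero_exact.
  by rewrite -(@fmor_id S R F _ y); apply/y0; exists y; exact: fmor_id.
rewrite -(@fmor_comp_eq X (zeromod S) Y \0 \0) //=.
by rewrite [fmor F _ x]F0 linear0.
Qed.

Lemma fmor_retract (X Y : fgmod S) (f : {linear X -> Y}) (g : {linear Y -> X}) :
  cancel f g -> cancel (fmor F f) (fmor F g).
Proof.
move=> fK x; have -> := @fmor_comp_eq _ _ _ g f idfun fK x.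
exact: fmor_id.
Qed.

(** In [0 -> F X -> F (X + Y) -> F Y -> 0], subtracting from an element the lift
    of its image in [F Y] along the section leaves an element of [F X]. *)
Lemma fmor_dsum_surj (X Y : fgmod S) (z : F (dsum X Y)) :
  exists x y, z = fmor F (pairing idfun \0 : {linear X -> dsum X Y}) x
                + fmor F (pairing \0 idfun : {linear Y -> dsum X Y}) y.
Proof.
pose i1 : {linear X -> dsum X Y} := pairing idfun \0.
pose i2 : {linear Y -> dsum X Y} := pairing \0 idfun.
pose p2 : {linear dsum X Y -> Y} := snd.
have ex : short_exact i1 p2.
  split=> [x x' []//||y]; last by exists (0, y).
  move=> [x y]; split=> [/= ->|[_ [_ <-]] //]; by exists x.
have [_ ker_p2 _] := F_exact ex.
have [|x xE] := (ker_p2 (z - fmor F i2 (fmor F p2 z))).1.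
  by rewrite linearB /= (@fmor_retract _ _ i2 p2) ?subrr.
by exists x, (fmor F p2 z); rewrite xE subrK.
Qed.

(** Both sides are quotients of [F M + F N], so it is enough to compare kernels.
    Exactness at [F (M + N)] gives an [l] whose first component is [x]; the
    second component is then forced, because [N -> M * N] is injective like [f],
    and so is its image under [F]. *)
Lemma functor_pushout (Theta M N : fgmod S)
    (f : {linear Theta -> M}) (g : {linear Theta -> N}) :
  injective f ->
  isomorphic (F (FGMod (pushout_fg f g))) (pushout (fmor F f) (fmor F g)).
Proof.
move=> f_inj; set P := FGMod _.
pose a : {linear M -> P} := @pushout_inl S Theta M N f g.
pose b : {linear N -> P} := @pushout_inr S Theta M N f g.
pose c : {linear dsum M N -> P} := copairing a b.
pose h : {linear Theta -> dsum M N} := pairing f (\- g).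
pose i1 : {linear M -> dsum M N} := pairing idfun \0.
pose i2 : {linear N -> dsum M N} := pairing \0 idfun.
pose p1 : {linear dsum M N -> M} := fst.
have ab l : fmor F a (fmor F f l) = fmor F b (fmor F g l).
  have -> := @fmor_comp_eq _ _ _ a f (a \o f : {linear Theta -> P}) (frefl _) l.
  symmetry; apply: (@fmor_comp_eq _ _ _ b g (a \o f : {linear Theta -> P})).
  by move=> {}l; rewrite /= -[RHS]/(pushout_inl f g (f l)) pushout_comm.
have ci1 x : fmor F c (fmor F i1 x) = fmor F a x.
  apply: (@fmor_comp_eq _ _ _ c i1 a) => {}x.
  by rewrite /c /copairing /= linear0 addr0.
have ci2 y : fmor F c (fmor F i2 y) = fmor F b y.
  apply: (@fmor_comp_eq _ _ _ c i2 b) => {}y.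
  by rewrite /c /copairing /= linear0 add0r.
have [_ ker_c c_surj] :=
  @F_exact Theta (dsum M N) P h c (pushout_short_exact g f_inj).
apply: isomorphic_sym.
pose a' := @pushout_inl R _ _ _ (fmor F f) (fmor F g).
pose b' := @pushout_inr R _ _ _ (fmor F f) (fmor F g).
apply: (@isomorphic_of_surj _ _ _ _ (copairing a' b')
  (copairing (fmor F a) (fmor F b))) => [||[x y]].
- exact: pushout_surj.
- move=> w; have [z <-] := c_surj w; have [x [y ->]] := fmor_dsum_surj z.
  exists (x, y); rewrite linearD.
  by congr (_ + _); symmetry; [exact: ci1|exact: ci2].
rewrite pushout_eq0; split=> [[l [<- <-]]|].
  by rewrite /copairing /= linearN /= ab subrr.
rewrite {1}/copairing /= => xy0.
have [|l lE] := (ker_c (fmor F i1 x + fmor F i2 y)).1.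
  by rewrite linearD -[RHS]xy0; congr (_ + _); [exact: ci1|exact: ci2].
have xE : x = fmor F f l.
  have := congr1 (fmor F p1) lE.
  rewrite linearD /= (@fmor_retract _ _ i1 p1) //.
  have -> : fmor F p1 (fmor F i2 y) = 0.
    have -> := @fmor_comp_eq _ _ _ p1 i2 \0 _ y; last by [].
    exact: fmor0.
  rewrite addr0 => <-.
  exact: (@fmor_comp_eq _ _ _ p1 h f).
(* Comparing second components directly would require [F (- g) = - F g]; it is
   the injectivity of [F b] that identifies [y] with [- F g l]. *)
exists l; rewrite xE; apply: injective_projections => //=.
apply/esym/eqP; rewrite -addr_eq0; apply/eqP.
apply: (@fmor_inj _ _ b (@pushout_inr_inj _ _ _ _ f g f_inj)).
by rewrite linear0 linearD /= -ab -xE addrC.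
Qed.

End ExactFunctor.

(** * Local endomorphism rings and indecomposability *)

Section Units.
Variable S : pzRingType.
Implicit Types u x : S.

Lemma invertible_mull u x : invertible u -> invertible (u * x) -> invertible x.
Proof.
move=> [v [vu uv]] [y [yux uxy]]; exists (y * u); split; first by rewrite -mulrA.
by rewrite -[x]mul1r -vu -[_ * _ * x]mulrA -mulrA [_ * x * _]mulrA uxy mul1r vu.
Qed.

Lemma invertible_1B_nilpotent x m : x ^+ m = 0 -> invertible (1 - x).
Proof.
move=> xm; exists (\sum_(i < m) x ^+ i).
have comm : GRing.comm (1 - x) (\sum_(i < m) x ^+ i).
  apply: commr_sum => i _; apply: commrX; apply/esym/commrB => //; exact: commr1.
suff H : (1 - x) * (\sum_(i < m) x ^+ i) = 1 by rewrite -comm H.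
by apply: oppr_inj; rewrite -mulNr opprB -subrX1 xm sub0r.
Qed.

End Units.

Section LocalEndomorphisms.
Variable R : pzRingType.

Lemma invertible_endo_inj (M : lmodType R) (f : endo M) :
  invertible f -> injective f.
Proof.
case=> g [gf _]; apply: (can_inj (g := g)) => x.
by rewrite -[LHS]/((g * f) x) gf.
Qed.

(** In a nontrivial decomposition the two complementary projections are not
    injective, hence are nonunits, but their sum is the identity. *)
Lemma local_endo_indecomposable (M : fgmod R) :
  local_ring (endo M) -> indecomposable M.
Proof.
move=> [endo_neq0 nonunitD]; split=> [M0|X Y [f /linear_inverse[g [fK gK]]]].
  by apply: endo_neq0; apply: linear_ext => x; exact: M0.
pose eX : endo M := g \o (pairing fst \0 \o f).
pose eY : endo M := g \o (pairing \0 snd \o f).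
have eXY : eX + eY = 1.
  apply: linear_ext => x; rewrite -[LHS]/(eX x + eY x) /= -linearD -[RHS]fK.
  by congr (g _); apply: injective_projections; rewrite /= ?addr0 ?add0r.
apply: contrapT => XY; case: (nonunitD eX eY).
- move=> /invertible_endo_inj eX_inj; apply: XY; right=> y.
  have /(congr1 f) : g (0, y) = 0.
    apply: eX_inj; rewrite [RHS]linear0.
    rewrite -[LHS]/(g (pairing fst \0 (f (g (0, y))))) gK; exact: (linear0 g).
  by rewrite gK linear0 => -[].
- move=> /invertible_endo_inj eY_inj; apply: XY; left=> x.
  have /(congr1 f) : g (x, 0) = 0.
    apply: eY_inj; rewrite [RHS]linear0.
    rewrite -[LHS]/(g (pairing \0 snd (f (g (x, 0))))) gK; exact: (linear0 g).
  by rewrite gK linear0 => -[].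
- by rewrite eXY; exists 1; rewrite mulr1.
Qed.

(** The splitting of [M] as image of [e] plus image of [1 - e] is expressed with
    the cokernels of [1 - e] and of [e], which are isomorphic to these images
    and are finitely generated as quotients of [M]. *)
Lemma indecomposable_idempotent (M : fgmod R) (e : endo M) :
  indecomposable M -> e * e = e -> e = 0 \/ e = 1.
Proof.
move=> [_ M_split] ee.
have eeE x : e (e x) = e x by rewrite -[LHS]/((e * e) x) ee.
pose d : {linear M -> M} := (1 - e : endo M).
have dE x : d x = x - e x by [].
have Msplit : isomorphic M (dsum (coker e) (coker d)).
  exists (pairing (coker_proj e) (coker_proj d)).
  apply: inj_surj_bijective => [|[a b]].
    apply: linear_inj0 => x [/coker_proj_eq0[y ey] /coker_proj_eq0[z dz]].
    by rewrite -ey -eeE ey -dz dE linearB /= eeE subrr.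
  have [x <-] := coker_proj_surj a; have [y <-] := coker_proj_surj b.
  exists (d x + e y); apply: injective_projections => /=;
    apply/subr0_eq; rewrite -linearB; apply/coker_proj_eq0.
    by exists (y - x); rewrite linearB addrAC [x - _]addrC addrK addrC.
  by exists (x - y); rewrite linearB /= opprB addrA.
case: (M_split _ _ Msplit) => coker0; [right|left]; apply: linear_ext => x.
  have /coker_proj_eq0[y <-] : coker_proj e x = 0 by exact: coker0.
  exact: eeE.
have /coker_proj_eq0[y <-] : coker_proj d x = 0 by exact: coker0.
by rewrite dE linearB /= eeE subrr.
Qed.

End LocalEndomorphisms.

(** * Fitting's lemma over a finite-dimensional algebra *)

Section Fitting.
Variables (k : fieldType) (A : falgType k) (M : fgmod A).

(** A finitely generated module is spanned over the base field by the products of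
    generators with a basis of the algebra.  The family has positive length,
    padded with one zero vector, so that matrices indexed by it form a
    nontrivial ring. *)
Lemma fgmod_span : exists (n : nat) (s : 'I_n.+1 -> M),
  forall x, exists c : 'I_n.+1 -> k, x = \sum_i (c i)%:A *: s i.
Proof.
have [m [g gP]] := fgmodP M.
pose b := vbasis {:A}; pose T : finType := ('I_m * 'I_(\dim {:A}))%type.
pose s (t : T) : M := b`_t.2 *: g t.1.
exists #|{: T}|, (fun i => if unlift ord0 i is Some j then s (enum_val j) else 0).
move=> x; have [a ->] := gP x.
pose c (t : T) : k := coord b t.2 (a t.1).
exists (fun i => if unlift ord0 i is Some j then c (enum_val j) else 0).
rewrite big_ord_recl unlift_none scaler0 add0r.
under [RHS]eq_bigr do rewrite liftK.
rewrite -(big_enum_val (fun t => (c t)%:A *: s t)) /=.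
rewrite -(pair_bigA _ (fun i j => (c (i, j))%:A *: s (i, j))) /=.
apply: eq_bigr => i _; rewrite {1}(coord_vbasis (memvf (a i))) scaler_suml.
by apply: eq_bigr => j _; rewrite scalerA mulr_algl.
Qed.

(** Linear over the algebra and not only over the base field, as the scalars
    [c%:A] are central. *)
Definition homothety (c : k) : M -> M := fun x => c%:A *: x.

Fact homothety_linear c : linear (homothety c).
Proof.
by move=> a x y; rewrite /homothety scalerDr !scalerA mulr_algl mulr_algr.
Qed.

HB.instance Definition _ c := GRing.isLinear.Build A M M *:%R
  (homothety c) (homothety_linear c).

Definition endo_scalar (c : k) : endo M := homothety c.

Lemma endo_scalarE c (f : endo M) x : (endo_scalar c * f) x = c%:A *: f x.
Proof. by []. Qed.

Lemma endo_scalarM c d : endo_scalar (c * d) = endo_scalar c * endo_scalar d.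
Proof.
apply: linear_ext => x; rewrite -[RHS]/(c%:A *: (d%:A *: x)) scalerA.
by rewrite mulr_algl scalerA.
Qed.

Lemma endo_scalar0 : endo_scalar 0 = 0.
Proof.
by apply: linear_ext => x; rewrite -[LHS]/(0%:A *: x) !scale0r.
Qed.

Lemma endo_scalar1 : endo_scalar 1 = 1.
Proof. by apply: linear_ext => x; rewrite -[LHS]/(1%:A *: x) !scale1r. Qed.

Lemma endo_scalarC c f : GRing.comm f (endo_scalar c).
Proof. by apply: linear_ext => x; exact: linearZ. Qed.

Lemma endo_sumE (I : Type) (r : seq I) (P : pred I) (F : I -> endo M) x :
  (\sum_(i <- r | P i) F i) x = \sum_(i <- r | P i) F i x.
Proof.
by elim/big_rec2: _ => // i y f _ <-.
Qed.

(** The action of [f] on a spanning family lifts to a matrix over the base field,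
    and any polynomial that annihilates the matrix annihilates [f]; the
    characteristic polynomial does so by Cayley-Hamilton. *)
Lemma endo_algebraic (f : endo M) : exists p : {poly k},
  p != 0 /\ \sum_(i < size p) endo_scalar p`_i * f ^+ i = 0.
Proof.
have [n [s sP]] := fgmod_span.
have /choice[c cP] i := sP (f (s i)).
pose C : 'M[k]_n.+1 := \matrix_(i, j) c i j.
have powC m i : (f ^+ m) (s i) = \sum_j ((C ^+ m) i j)%:A *: s j.
  elim: m i => [|m IHm] i.
    rewrite (bigD1 i) //= big1 => [|j /negPf ji]; rewrite !mxE.
      by rewrite eqxx !scale1r addr0.
    by rewrite eq_sym ji !scale0r.
  rewrite exprS -[LHS]/(f ((f ^+ m) (s i))) IHm linear_sum.
  under eq_bigr do rewrite linearZ /= cP scaler_sumr.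
  rewrite exchange_big; apply: eq_bigr => j _ /=.
  rewrite exprSr mxE !scaler_suml; apply: eq_bigr => l _.
  by rewrite mxE scalerA mulr_algl scalerA.
pose p := char_poly C; exists p; split; first exact/monic_neq0/char_poly_monic.
have pC i j : \sum_(m < size p) p`_m * (C ^+ m) i j = 0.
  have /matrixP/(_ i j) := Cayley_Hamilton C.
  rewrite -/p /horner_mx /horner_morph horner_coef size_map_poly summxE [RHS]mxE.
  move=> pC0; rewrite -[RHS]pC0; apply: eq_bigr => m _; rewrite coef_map /=.
  by rewrite -[_%:M * _]/(_%:M *m _) mul_scalar_mx mxE.
have pf0 i : (\sum_(m < size p) endo_scalar p`_m * f ^+ m) (s i) = 0.
  rewrite endo_sumE.
  under eq_bigr do rewrite endo_scalarE powC scaler_sumr.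
  rewrite exchange_big big1 // => j _ /=.
  under eq_bigr do rewrite scalerA mulr_algl scalerA.
  by rewrite -!scaler_suml pC !scale0r.
apply: linear_ext => x; have [d ->] := sP x.
by rewrite linear_sum big1 // => i _; rewrite linearZ /= pf0 scaler0.
Qed.

(** Take an annihilating polynomial and solve for the nonzero term of lowest
    degree [m]: it is [f ^+ m.+1] times a polynomial in [f]. *)
Lemma endo_strongly_pi_regular (f : endo M) : exists (m : nat) (g : endo M),
  GRing.comm f g /\ f ^+ m = f ^+ m.+1 * g.
Proof.
have [p [p_neq0 pf0]] := endo_algebraic f.
have ex_coef : exists i, p`_i != 0.
  by exists (size p).-1; rewrite -lead_coefE lead_coef_eq0.
case: (ex_minnP ex_coef) => m pm_neq0 m_min.
have m_lt : (m < size p)%N.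
  by rewrite ltnNge; apply: contra pm_neq0 => /(nth_default 0)->.
have tail : \sum_(m <= i < size p) endo_scalar p`_i * f ^+ i = 0.
  rewrite -[RHS]pf0 -(big_mkord xpredT (fun i => endo_scalar p`_i * f ^+ i)).
  rewrite [RHS](big_cat_nat (n := m)) ?(ltnW m_lt) //=.
  rewrite [X in _ = X + _]big_nat [X in _ = X + _]big1 ?add0r //.
  move=> i /andP[_ im]; suff /eqP-> : p`_i == 0 by rewrite endo_scalar0 mul0r.
  by apply: contraLR im => /m_min; rewrite -leqNgt.
exists m, (- \sum_(j < size p - m.+1)
  endo_scalar ((p`_m)^-1 * p`_(j + m.+1)) * f ^+ j); split.
  apply/commrN/commr_sum => j _; apply: commrM; first exact: endo_scalarC.
  exact: commrX.
rewrite mulrN; apply/eqP; rewrite -addr_eq0; apply/eqP.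
rewrite -[RHS](mulr0 (endo_scalar (p`_m)^-1)) -[X in _ = _ * X]tail.
rewrite [in RHS]big_ltn // mulrDr mulrA -endo_scalarM mulVf // endo_scalar1.
rewrite mul1r; congr (_ + _).
have shift (G : nat -> endo M) :
    \sum_(m.+1 <= i < size p) G i = \sum_(j < size p - m.+1) G (j + m.+1)%N.
  by rewrite -{1}[m.+1]add0n big_addn big_mkord.
rewrite shift !mulr_sumr.
apply: eq_bigr => j _; rewrite mulrA endo_scalarC -mulrA -exprD addnC.
by rewrite mulrA -endo_scalarM.
Qed.

(** From [f ^+ m = f ^+ m.+1 * g], multiplication by [f * g] fixes [f ^+ m.+1], so
    [(f * g) ^+ m.+1] is idempotent.  If it is [0] then [f ^+ m.+1 = 0]; if it is
    [1] then [f] divides [1] on both sides. *)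
Lemma fitting (f : endo M) :
  indecomposable M -> invertible f \/ exists m, f ^+ m = 0.
Proof.
move=> M_indec; have [m [g [fg fm]]] := endo_strongly_pi_regular f.
have f_fg : GRing.comm f (f * g) by exact: commrM.
have g_fg : GRing.comm g (f * g) by apply: commrM => //; exact/esym.
have fm_fg : f ^+ m.+1 * (f * g) = f ^+ m.+1.
  by rewrite mulrA -exprSr (exprS f m.+1) -mulrA -fm -exprS.
have fmX i : f ^+ m.+1 = f ^+ m.+1 * (f * g) ^+ i.
  elim: i => [|i IHi]; first by rewrite mulr1.
  by rewrite (exprS (f * g)) mulrA fm_fg.
(* The exponent is [m.+1], not [m], so that a factor [f] can be extracted when
   [e = 1], even if [m] is zero. *)
pose e := (f * g) ^+ m.+1.
have eE : e = g ^+ m.+1 * f ^+ m.+1 by rewrite /e fg exprMn_comm.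
have ee : e * e = e by rewrite {1}eE -mulrA -fmX -eE.
have [e0|e1] := indecomposable_idempotent M_indec ee; [right|left].
  by exists m.+1; rewrite (fmX m.+1) -/e e0 mulr0.
exists (g * (f * g) ^+ m); split.
  rewrite -mulrA -(commrX m f_fg) mulrA -fg -exprS; exact: e1.
by rewrite mulrA -exprS; exact: e1.
Qed.

(** If [f + g] has inverse [u] and [f] is a nonunit, then so is [u * f], which is
    therefore nilpotent; hence [u * g = 1 - u * f] is a unit, and so is [g]. *)
Lemma indecomposable_local_endo : indecomposable M -> local_ring (endo M).
Proof.
move=> M_indec; split=> [one0|f g f_nu g_nu [u [ufg fgu]]].
  by case: M_indec => + _; apply=> x; rewrite -[x]/((1 : endo M) x) one0.
have uf_nu : ~ invertible (u * f).
  by move=> /(invertible_mull (ex_intro _ _ (conj fgu ufg))).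
have [//|[m ufm]] := fitting (u * f) M_indec.
apply/g_nu/(invertible_mull (ex_intro _ _ (conj fgu ufg))).
have -> : u * g = 1 - u * f by rewrite -ufg mulrDr addrC addKr.
exact: invertible_1B_nilpotent ufm.
Qed.

End Fitting.

(** * Images of dense chains *)

Lemma pointed_iso_isomorphic (R : pzRingType) (Theta : fgmod R)
    (M N : pointed Theta) :
  pointed_iso M N -> isomorphic M N.
Proof. by case=> f [_ f_bij]; exists f. Qed.

Section Images.
Variables (S R : pzRingType) (F : functor S R) (Theta : fgmod S).
Hypothesis F_emb : representation_embedding F.

Lemma functor_pointed_hom (M N : pointed Theta) (f : {linear M -> N}) :
  pointed_hom f ->
  pointed_hom (fmor F f : {linear pointed_image F M -> pointed_image F N}).
Proof.
move=> fP l; exact: (@fmor_comp_eq S R F Theta M N f (chi M) (chi N) fP l).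
Qed.

(** Strongness is what makes the images pairwise non-isomorphic: [F] reflects
    isomorphism of modules, whereas a pointed isomorphism between images need
    not lift to a pointed one. *)
Lemma functor_dense_chain (F_local : forall X : fgmod R,
    indecomposable X -> local_ring (endo X))
    (Theta_neq0 : ~ trivial_mod (F Theta))
    (d : Order.disp_t) (C : orderType d) (M : C -> pointed Theta) :
  (forall q, injective (chi (M q))) ->
  strong_dense_chain M -> dense_chain (fun q => pointed_image F (M q)).
Proof.
case: F_emb => F_exact F_refl F_indec M_mono [[QC M_local M_hom _] M_strong].
split=> // [q|q q' /M_hom[f /functor_pointed_hom fP]|q q' qq'].
- split.
    exact/F_local/F_indec/local_endo_indecomposable/(M_local q).1.
  move=> chi0; apply: Theta_neq0 => l.
  by apply: (fmor_inj F_exact (M_mono q)); rewrite linear0; exact: chi0.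
- by exists (fmor F f).
- move=> /pointed_iso_isomorphic/F_refl MqMq'.
  case: (ltgtP q q') => [lt_qq'|lt_q'q|//]; first exact: M_strong MqMq'.
  exact/(M_strong _ _ lt_q'q)/isomorphic_sym.
Qed.

End Images.

Theorem theorem4p1 (k : closedFieldType) (A B : falgType k)
    (basicA : basic A) (basicB : basic B)
    (F : functor B A) (F_emb : representation_embedding F)
    (Theta : fgmod B) (Theta_indec : indecomposable Theta)
    (d1 d2 : Order.disp_t) (C1 : orderType d1) (C2 : orderType d2)
    (M : C1 -> pointed Theta) (N : C2 -> pointed Theta)
    (MN_strong : strong_independent_pair M N)
    (M_mono : forall q : C1, injective (chi (M q)))
    (N_mono : forall t : C2, injective (chi (N t))) :
  independent_pair (fun q : C1 => pointed_image F (M q))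
                   (fun t : C2 => pointed_image F (N t)).
Proof.
have [F_exact F_refl F_indec] := F_emb.
have [[_ _ MN_local _] M_strong N_strong MN_noniso] := MN_strong.
have FTheta_neq0 := (F_indec Theta Theta_indec).1.
have F_local (X : fgmod A) : indecomposable X -> local_ring (endo X).
  exact: indecomposable_local_endo.
have FMN q t : isomorphic (F (pointed_pushout (M q) (N t)))
    (pointed_pushout (pointed_image F (M q)) (pointed_image F (N t))).
  exact: functor_pushout.
have FMN_refl q q' t t' :
    pointed_iso
      (pointed_pushout (pointed_image F (M q)) (pointed_image F (N t)))
      (pointed_pushout (pointed_image F (M q')) (pointed_image F (N t'))) ->
    isomorphic (pointed_pushout (M q) (N t)) (pointed_pushout (M q') (N t')).
  move=> /pointed_iso_isomorphic iso; apply: F_refl.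
  apply: isomorphic_trans (FMN q t) _.
  exact: isomorphic_trans iso (isomorphic_sym (FMN q' t')).
split; [exact: functor_dense_chain|exact: functor_dense_chain|move=> q t|].
  apply/F_local/(indecomposable_iso (FMN q t))/F_indec.
  exact: local_endo_indecomposable.
move=> q q' t t' qq' tt'; have [nM nN] := MN_noniso q q' t t' qq' tt'.
by split=> /FMN_refl.
Qed.
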